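(* Let $0<\mu<\beta$, $0\le\underline{\sigma}\le\bar{\sigma}\le\sqrt{\mu(\beta-\mu)}$ and $\bar\sigma>0$. Let $\tilde R(p)=\inf_{\mathbb{P}\in\mathcal{P}(\mu,\underline{\sigma},\bar{\sigma},\beta)}p\,\mathbb{P}(X\ge p)$ for $p\in(0,\beta]$. Then the optimal robust price $p^*=\arg\sup_{p}\tilde R(p)$ is contained in $\{p^*_l(\bar\sigma),p^*_m(\beta),p^*_h(\underline\sigma,\beta)\}$; precisely, the supremum of $\tilde R$ is attained at $$p^*=\begin{cases}p^*_l(\bar\sigma)&\text{if }(\underline\sigma,\bar\sigma)\in\Sigma_l,\\ p^*_m(\beta)&\text{if }(\underline\sigma,\bar\sigma)\in\Sigma_m,\\ p^*_h(\underline\sigma,\beta)&\text{if }(\underline\sigma,\bar\sigma)\in\Sigma_h,\end{cases}$$ and $\Sigma_l\cup\Sigma_m\cup\Sigma_h$ contains all such pairs $(\underline\sigma,\bar\sigma)$ (on overlaps of these sets, each of the corresponding prices attains the supremum).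
   Context: $\mathcal{P}(\mu,\underline{\sigma},\bar{\sigma},\beta)$ is the set of all Borel probability distributions $\mathbb{P}$ of a random variable $X$ with $\mathbb{P}(X\in[0,\beta])=1$, $\mathbb{E}(X)=\mu$ and $\mathbb{E}(X^2)\in[\underline\sigma^2+\mu^2,\bar\sigma^2+\mu^2]$. Price functions: $p^*_h(\underline\sigma,\beta)=\beta-\sqrt{\beta\left(\beta-\mu-\underline\sigma^2/\mu\right)}$, $p^*_m(\beta)=\beta-\sqrt{\beta(\beta-\mu)}$, $p^*_l(\bar\sigma)=\mu-\bar\sigma\,\kappa(\mu,\bar\sigma)$, where (with real cube roots) $$\kappa(\mu,\bar\sigma)=\left(\tfrac{\mu}{\bar\sigma}+\sqrt{1+(\tfrac{\mu}{\bar\sigma})^2}\right)^{1/3}+\left(\tfrac{\mu}{\bar\sigma}-\sqrt{1+(\tfrac{\mu}{\bar\sigma})^2}\right)^{1/3}.$$ Let $R_1(p)=\frac{p(\mu-p)^2}{(\mu-p)^2+\bar\sigma^2}$ and $R_2(p)=\frac{p(\mu-p)}{\beta-p}$. Define $f(\mu,\beta)=\left(\tfrac{32}{27}(\beta-\mu)\left(\sqrt{\beta(\beta-\mu)}-(\beta-\mu)\right)\right)^{1/2}$, $g(\mu,\beta)=\left(2\beta\sqrt{R_2(p^*_m(\beta))\mu}-\beta R_2(p^*_m(\beta))-\mu^2\right)^{1/2}$, $h(\bar\sigma,\mu,\beta)=\left(2\beta\sqrt{R_1(p^*_l(\bar\sigma))\mu}-\beta R_1(p^*_l(\bar\sigma))-\mu^2\right)^{1/2}$,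 with the convention $h=0$ if the expression under the outer square root is negative. Risk sets (subsets of $\mathbb{R}_+^2$): $\Sigma_l=\{(\underline\sigma,\bar\sigma):\underline\sigma\le h(\bar\sigma,\mu,\beta),\ \bar\sigma\le f(\mu,\beta),\ \underline\sigma\le\bar\sigma\}$, $\Sigma_m=\{(\underline\sigma,\bar\sigma):\underline\sigma\le g(\mu,\beta),\ \bar\sigma\ge f(\mu,\beta),\ \underline\sigma\le\bar\sigma\}$, $\Sigma_h=\{(\underline\sigma,\bar\sigma):\underline\sigma\ge g(\mu,\beta),\ \underline\sigma\ge h(\bar\sigma,\mu,\beta),\ \underline\sigma\le\bar\sigma\}$. *)

(* Defs.v *)
From HB Require Import structures.
From mathcomp Require Import all_boot all_order all_algebra.
From mathcomp Require Import all_classical all_reals all_analysis.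
Set Implicit Arguments.
Unset Strict Implicit.
Unset Printing Implicit Defensive.
Import Order.TTheory GRing.Theory Num.Theory.
Import numFieldNormedType.Exports.
Local Open Scope classical_set_scope.
Local Open Scope ring_scope.

(* Argument names: slo and shi are the lower and upper bounds on the standard
   deviation of the valuation. *)

(* The ambiguity set, as a set of laws on the Borel line: the random variable
   is the identity. *)
Definition ambiguity_set (R : realType) (mu slo shi beta : R) :
    set (probability (measurableTypeR R) R) :=
  [set P : probability (measurableTypeR R) R |
    [/\ P [set x | 0 <= x <= beta] = 1%E,
        ('E_P[(fun x : measurableTypeR R => x : R)] = mu%:E)%E
      & ((slo ^+ 2 + mu ^+ 2)%R%:E
           <= 'E_P[(fun x : measurableTypeR R => ((x : R) ^+ 2)%R)]
           <= (shi ^+ 2 + mu ^+ 2)%R%:E)%E ] ].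

(* The infimum is taken in \bar R, so that no default value is involved. *)
Definition robust_revenue (R : realType) (mu slo shi beta p : R) : \bar R :=
  ereal_inf [set (p%:E * P [set x | p <= x]%R)%E
            | P in ambiguity_set mu slo shi beta].

Definition optimal_robust_prices (R : realType) (mu slo shi beta : R) : set R :=
  [set p | 0 < p <= beta /\
    robust_revenue mu slo shi beta p =
    ereal_sup [set robust_revenue mu slo shi beta q
              | q in [set q | 0 < q <= beta]] ].

(* Real cube root, odd in x; the sign is split off because the library power
   a `^ x is the usual one only for a >= 0. *)
Definition cbrt (R : realType) (x : R) : R := Num.sg x * `|x| `^ (3%:R^-1).

Definition kappa (R : realType) (mu shi : R) : R :=
  cbrt (mu / shi + Num.sqrt (1 + (mu / shi) ^+ 2)) +
  cbrt (mu / shi - Num.sqrt (1 + (mu / shi) ^+ 2)).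

Definition price_h (R : realType) (mu slo beta : R) : R :=
  beta - Num.sqrt (beta * (beta - mu - slo ^+ 2 / mu)).

Definition price_m (R : realType) (mu beta : R) : R :=
  beta - Num.sqrt (beta * (beta - mu)).

Definition price_l (R : realType) (mu shi : R) : R := mu - shi * kappa mu shi.

Definition R1 (R : realType) (mu shi p : R) : R :=
  p * (mu - p) ^+ 2 / ((mu - p) ^+ 2 + shi ^+ 2).

Definition R2 (R : realType) (mu beta p : R) : R :=
  p * (mu - p) / (beta - p).

Definition f (R : realType) (mu beta : R) : R :=
  Num.sqrt (32%:R / 27%:R * (beta - mu) *
            (Num.sqrt (beta * (beta - mu)) - (beta - mu))).

Definition g (R : realType) (mu beta : R) : R :=
  Num.sqrt (2%:R * beta * Num.sqrt (R2 mu beta (price_m mu beta) * mu)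
            - beta * R2 mu beta (price_m mu beta) - mu ^+ 2).

(* Num.sqrt vanishes on negative numbers, which is the convention made for h. *)
Definition h (R : realType) (shi mu beta : R) : R :=
  Num.sqrt (2%:R * beta * Num.sqrt (R1 mu shi (price_l mu shi) * mu)
            - beta * R1 mu shi (price_l mu shi) - mu ^+ 2).

Definition Sigma_l (R : realType) (mu beta : R) : set (R * R) :=
  [set s | [/\ 0 <= s.1, 0 <= s.2,
               s.1 <= h s.2 mu beta, s.2 <= f mu beta & s.1 <= s.2] ].

Definition Sigma_m (R : realType) (mu beta : R) : set (R * R) :=
  [set s | [/\ 0 <= s.1, 0 <= s.2,
               s.1 <= g mu beta, f mu beta <= s.2 & s.1 <= s.2] ].

Definition Sigma_h (R : realType) (mu beta : R) : set (R * R) :=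
  [set s | [/\ 0 <= s.1 /\ 0 <= s.2,
               g mu beta <= s.1, h s.2 mu beta <= s.1 & s.1 <= s.2] ].

(* Main.v *)
Require Import Defs.
From HB Require Import structures.
From mathcomp Require Import all_boot all_order all_algebra.
From mathcomp Require Import all_classical all_reals all_analysis.
From mathcomp Require Import measurable_realfun ring lra.
Import Order.TTheory GRing.Theory Num.Theory.
Import numFieldNormedType.Exports.
Local Open Scope classical_set_scope.
Local Open Scope ring_scope.

(* For each price p the worst-case sale probability is the maximum of three explicit lower
   bounds, obtained by integrating quadratic minorants of the indicator of [p, +oo[: Cantelli's
   bound (giving R1), the chord bound (x - p) / (beta - p) (giving R2) and
   x (x - p) / (beta (beta - p)) (giving a multiple of R2 with mu replaced by mu + slo^2 / mu,
   called R3 in lemma names).  At every p one of the bounds, or 0, is approached by laws with at most three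
   atoms, one of them slightly below p.  Hence sup of the revenue is the largest of the maxima of
   R1, R2 and R3 over p, each attained only at price_l, price_m and price_h respectively.  With
   y = shi * kappa, the root of y^3 + 3 shi^2 y = 2 mu shi^2, max R1 = mu - 3 y / 2 and
   max R2 = (beta - r)^2 / beta for r = sqrt (beta (beta - mu)), so that comparing the maxima
   pairwise gives the thresholds f, g and h. *)

(** * Revenue bounds from quadratic minorants and three-point laws *)

Section BoundedRandomVariable.
Context {R : realType} {d : measure_display} {T : measurableType d}.
Context {P : probability T R} {X : T -> R} {beta : R}.
Hypothesis mX : measurable_fun setT X.
Let D : set T := [set x | 0 <= X x <= beta].
Hypothesis PD : P D = 1%E.

Let mD : measurable D.
Proof.
rewrite (_ : D = X @^-1` `[0, beta]).
  by rewrite -[X in measurable X]setTI; exact: mX.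
by apply/seteqP; split=> x; rewrite /D /= in_itv.
Qed.

Let integrable_power k : P.-integrable D (fun x => (X x ^+ k)%:E).
Proof.
have mXD : measurable_fun D X by exact: measurable_funS mX.
apply: measurable_bounded_integrable => //.
- by have : (P D < +oo)%E by rewrite PD ltry.
- exact: measurable_funX.
- exists (beta ^+ k); split; first by rewrite num_real.
  move=> M hM x /= /andP[x0 xb]; apply: (le_trans _ (ltW hM)).
  rewrite ger0_norm ?exprn_ge0//; apply: lerXn2r; rewrite // ?nnegrE //.
  exact: le_trans xb.
Qed.

Let integral_restrict k :
  (\int[P]_x (X x ^+ k)%:E = \int[P]_(x in D) (X x ^+ k)%:E)%E.
Proof.
have PN : P (~` D) = 0 by rewrite probability_setC // PD subee.
have DE : D = setT `\` ~` D by rewrite setTD setCK.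
rewrite [in RHS]DE; apply: negligible_integral => //; first exact: measurableC.
apply/(negligible_integrable (N := ~` D)) => //; first exact: measurableC.
- exact/measurable_EFinP/measurable_funX.
- by rewrite -DE; exact: integrable_power.
Qed.

(** The minorant is integrated over [D], which carries all the mass. The witness [m] is the second
    moment of [X], known only up to an interval; leaving it existential lets the caller use either
    endpoint, according to the sign of [c]. *)
Lemma quadratic_minorant_le (a b c mu v1 v2 : R) (A : set T) :
  ('E_P[X] = mu%:E)%E ->
  (v1%:E <= 'E_P[(fun x => (X x ^+ 2)%R)] <= v2%:E)%E ->
  measurable A ->
  (forall x, 0 <= X x <= beta -> a + b * X x + c * X x ^+ 2 <= \1_A x) ->
  exists2 m, v1 <= m <= v2 & ((a + b * mu + c * m)%:E <= P A)%E.
Proof.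
move=> EX EX2 mA hA.
pose m := fine (\int[P]_(x in D) (X x ^+ 2)%:E).
have mE : (\int[P]_(x in D) (X x ^+ 2)%:E = m%:E)%E.
  by rewrite /m fineK //; apply: integrable_fin_num => //; exact: integrable_power.
exists m; first by move: EX2; rewrite unlock integral_restrict mE !lee_fin.
have EXD : (\int[P]_(x in D) (X x ^+ 1)%:E = mu%:E)%E.
  by rewrite -EX unlock -integral_restrict.
have E0 : (\int[P]_(x in D) (X x ^+ 0)%:E = 1)%E.
  by under eq_integral do rewrite expr0; rewrite integral_cst // mul1e; exact: PD.
have -> : ((a + b * mu + c * m)%:E = \int[P]_(x in D)
    (a%:E * (X x ^+ 0)%:E + b%:E * (X x ^+ 1)%:E + c%:E * (X x ^+ 2)%:E))%E.
  rewrite integralD //; first last.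
  - by apply: integrableZl => //; exact: integrable_power.
  - by apply: integrableD => //; apply: integrableZl => //; exact: integrable_power.
  rewrite integralD //; [|by apply: integrableZl => //; exact: integrable_power..].
  rewrite !integralZl //; [|exact: integrable_power..].
  by rewrite mE EXD E0 mule1.
apply: (@le_trans _ _ (\int[P]_(x in D) (\1_A x)%:E)%E); last first.
  by rewrite integral_indic // le_measure ?inE//; exact: measurableI.
apply: le_integral => //.
- by apply: integrableD => //; [apply: integrableD => //|]; apply: integrableZl => //;
    exact: integrable_power.
- apply: measurable_bounded_integrable => //.
  + by have : (P D < +oo)%E by rewrite PD ltry.
  + exists 1; split=> // M M1 x _; apply: (le_trans _ (ltW M1)).
    by rewrite /= indicE; case: (_ \in _); rewrite ?normr1 ?normr0.
- by move=> x /[!inE] xD; rewrite lee_fin expr0 expr1 mulr1; exact: hA.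
Qed.
End BoundedRandomVariable.

(** * Laws with at most three atoms *)

Section ThreePoints.
Context {R : realType} {d : measure_display} {T : measurableType d}.
Context {w1 w2 w3 : R} (x1 x2 x3 : T).
Hypothesis w1_ge0 : 0 <= w1.
Hypothesis w2_ge0 : 0 <= w2.
Hypothesis w3_ge0 : 0 <= w3.
Hypothesis w_sum : w1 + w2 + w3 = 1.

(** Weights may vanish, so two-atom laws are included by giving the third atom weight 0. *)
Definition three_points : set T -> \bar R :=
  measure_add (measure_add (mscale (NngNum w1_ge0) \d_x1) (mscale (NngNum w2_ge0) \d_x2))
              (mscale (NngNum w3_ge0) \d_x3).
HB.instance Definition _ := Measure.on three_points.

Lemma three_pointsE A : (three_points A =
  (w1 * \1_A x1 + w2 * \1_A x2 + w3 * \1_A x3)%:E)%E.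
Proof. by rewrite /three_points measure_addE [X in (X + _)%E]measure_addE. Qed.

Let three_points_setT : three_points setT = 1%E.
Proof. by rewrite three_pointsE !indicT !mulr1 w_sum. Qed.

HB.instance Definition _ := Measure_isProbability.Build _ _ _ three_points three_points_setT.

Definition three_points_law : probability T R := three_points.

Lemma expectation_three_points (X : T -> R) : measurable_fun setT X ->
  ('E_three_points_law[X] = (w1 * X x1 + w2 * X x2 + w3 * X x3)%:E)%E.
Proof.
move=> mX; rewrite unlock.
have mX' : measurable_fun setT (EFin \o X) by exact/measurable_EFinP.
(* Nonnegative functions come first; [X] is then recombined from its positive and negative parts. *)
have ge0_integral (Y : T -> \bar R) : measurable_fun setT Y -> (forall x, 0 <= Y x)%E ->
    (\int[three_points]_x Y x = w1%:E * Y x1 + w2%:E * Y x2 + w3%:E * Y x3)%E.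
  move=> mY Y0; rewrite /three_points ge0_integral_measure_add //.
  rewrite ge0_integral_measure_add // !ge0_integral_mscale //.
  by rewrite !integral_dirac // !diracT !mul1e.
rewrite integralE !ge0_integral //; [|exact: measurable_funeneg|exact: measurable_funepos].
have posnegE x : X x = Num.max (X x) 0 - Num.max (- X x) 0 by do 2!case: leP => ?; lra.
rewrite !funeposE !funenegE /= -!EFin_max -!EFinM -!EFinD; congr EFin.
rewrite [in RHS](posnegE x1) [in RHS](posnegE x2) [in RHS](posnegE x3); ring.
Qed.
End ThreePoints.

(** * Two-sided estimates of the robust revenue *)

Section RobustRevenue.
Context {R : realType} {mu slo shi beta : R}.
Implicit Types p q x : R.
Local Notation revenue := (robust_revenue mu slo shi beta).
Local Notation m_lo := (slo ^+ 2 + mu ^+ 2).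
Local Notation m_hi := (shi ^+ 2 + mu ^+ 2).

Lemma measurable_ge p : measurable ([set x | p <= x] : set (measurableTypeR R)).
Proof.
rewrite (_ : [set x | p <= x] = `[p, +oo[%classic); first exact: measurable_itv.
by apply/seteqP; split=> x /=; rewrite in_itv /= andbT.
Qed.

Lemma mem_ge p x : (x \in [set x | p <= x]) = (p <= x).
Proof. by apply/idP/idP; rewrite inE. Qed.

Lemma ambiguity_set_tail_ge (P : probability (measurableTypeR R) R) (a b c v p : R) :
  ambiguity_set mu slo shi beta P ->
  (forall x, 0 <= x <= beta -> a + b * x + c * x ^+ 2 <= (p <= x)%R%:R) ->
  (forall m, m_lo <= m <= m_hi -> v <= a + b * mu + c * m) ->
  (v%:E <= P [set x | p <= x]%R)%E.
Proof.
move=> [P1 EX EX2] minor hv.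
have mid : measurable_fun setT (fun x : measurableTypeR R => x : R) by exact: measurable_id.
have [|m hm le] := quadratic_minorant_le mid P1 a b c _ _ _ _ EX EX2 (measurable_ge p).
  by move=> x hx; rewrite indicE mem_ge; exact: minor.
by apply: le_trans le; rewrite lee_fin; exact: hv.
Qed.

Lemma robust_revenue_ge (a b c v p : R) : 0 <= p ->
  (forall x, 0 <= x <= beta -> a + b * x + c * x ^+ 2 <= (p <= x)%R%:R) ->
  (forall m, m_lo <= m <= m_hi -> v <= a + b * mu + c * m) ->
  ((p * v)%:E <= revenue p)%E.
Proof.
move=> p0 minor hv; apply: le_ereal_inf_tmp => _ [P PA <-].
rewrite EFinM lee_wpmul2l ?lee_fin //.
exact: ambiguity_set_tail_ge PA minor hv.
Qed.

Lemma robust_revenue_le (w1 w2 w3 x1 x2 x3 p : R) :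
  0 <= w1 -> 0 <= w2 -> 0 <= w3 -> w1 + w2 + w3 = 1 ->
  0 <= x1 <= beta -> 0 <= x2 <= beta -> 0 <= x3 <= beta ->
  w1 * x1 + w2 * x2 + w3 * x3 = mu ->
  m_lo <= w1 * x1 ^+ 2 + w2 * x2 ^+ 2 + w3 * x3 ^+ 2 <= m_hi ->
  (revenue p <= (p * (w1 * (p <= x1)%R%:R + w2 * (p <= x2)%R%:R + w3 * (p <= x3)%R%:R))%:E)%E.
Proof.
move=> w10 w20 w30 w1E hx1 hx2 hx3 muE m2E.
pose P := three_points_law (x1 : measurableTypeR R) x2 x3 w10 w20 w30 w1E.
have PE A : P A = (w1 * \1_A x1 + w2 * \1_A x2 + w3 * \1_A x3)%:E by exact: three_pointsE.
apply: ereal_inf_lbound; exists P; last first.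
  by rewrite PE !indicE !mem_ge -EFinM.
split.
- have memD x : 0 <= x <= beta -> (x \in [set x : R | 0 <= x <= beta]) = true.
    by move=> hx; apply/idP; rewrite inE.
  by rewrite PE !indicE !memD // !mulr1 w1E.
- by rewrite expectation_three_points ?muE.
- by rewrite expectation_three_points ?lee_fin //; exact: measurable_funX.
Qed.
End RobustRevenue.

(** An atom at [p] itself would count as a sale, so the worst case is only approached: the bad atom
    sits at [q < p], and this lemma lets [q] tend to [p]. *)
Lemma ereal_le_continuous {R : realType} (F : R -> R) (x : \bar R) (lo p : R) :
  lo < p -> {for p, continuous F} ->
  (forall q, lo < q < p -> (x <= (F q)%:E)%E) -> (x <= (F p)%:E)%E.
Proof.
move=> lop cF hF.
have cF' : F q @[q --> p^'-] --> F p by apply: cvg_at_left_filter.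
case: x hF => [r|/(_ ((lo + p) / 2))|] hF; last by rewrite leNye.
  rewrite lee_fin -(cvg_lim _ cF') //; apply: limr_ge; first by apply/cvg_ex; exists (F p).
  near=> q; rewrite -lee_fin; apply: hF; apply/andP; split; near: q.
    exact: nbhs_left_gt.
  exact: nbhs_left_lt.
suff : (+oo <= (F ((lo + p) / 2))%:E)%E by rewrite leye_eq.
by apply: hF; apply/andP; split; lra.
Unshelve. all: by end_near. Qed.

(** * Lower bounds on the revenue *)

Section TailBounds.
Context {R : realType} {mu slo shi beta : R}.
Implicit Types p q x : R.
Local Notation revenue := (robust_revenue mu slo shi beta).

Lemma R1_le_revenue p : 0 <= p < mu -> ((R1 mu shi p)%:E <= revenue p)%E.
Proof.
case/andP=> p0 pmu; pose v := mu - p; have v0 : 0 < v by rewrite /v; lra.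
have d0 : 0 < v ^+ 2 + shi ^+ 2 by have := sqr_ge0 shi; nra.
(* The minorant is [1 - k (x - t)^2], with apex 1 at [t] and scaled by [k] to vanish at [p]. The
   points [p] and [t] are the atoms of the two-point law of mean [mu] and variance [shi^2]. *)
pose t := mu + shi ^+ 2 / v; pose k := v ^+ 2 / (v ^+ 2 + shi ^+ 2) ^+ 2.
have k0 : 0 <= k by rewrite divr_ge0 // sqr_ge0.
have tp : t - p = (v ^+ 2 + shi ^+ 2) / v by rewrite /t /v; field; rewrite gt_eqF.
have kt : k * (t - p) ^+ 2 = 1 by rewrite tp /k; field; rewrite !gt_eqF.
have tp0 : 0 < t - p by rewrite tp divr_gt0.
have -> : R1 mu shi p = p * (v ^+ 2 / (v ^+ 2 + shi ^+ 2)) by rewrite /R1 mulrA.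
apply: (@robust_revenue_ge _ _ _ _ _ (1 - k * t ^+ 2) (2 * k * t) (- k)) => //.
  move=> x _; have -> : 1 - k * t ^+ 2 + 2 * k * t * x + - k * x ^+ 2 = 1 - k * (x - t) ^+ 2 by ring.
  have [px|xp] := leP p x; first by rewrite lerBlDr lerDl mulr_ge0 // sqr_ge0.
  by rewrite -kt -mulrBr mulr_ge0_le0 // subr_sqr mulr_ge0_le0 //; lra.
move=> m /andP[_ hm]; apply: (@le_trans _ _ (1 - k * t ^+ 2 + 2 * k * t * mu + - k * (shi ^+ 2 + mu ^+ 2))).
  rewrite le_eqVlt; apply/predU1l; rewrite /k /t /v; field.
  by rewrite !gt_eqF //; rewrite -/v.
by rewrite lerD2l !mulNr lerN2 ler_wpM2l.
Qed.

Lemma R2_le_revenue p : 0 <= p < beta -> ((R2 mu beta p)%:E <= revenue p)%E.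
Proof.
case/andP=> p0 pb; have d0 : 0 < beta - p by lra.
have -> : R2 mu beta p = p * ((mu - p) / (beta - p)) by rewrite /R2 mulrA.
apply: (@robust_revenue_ge _ _ _ _ _ (- p / (beta - p)) (beta - p)^-1 0) => //; last first.
  by move=> m _; rewrite le_eqVlt; apply/predU1l; ring.
move=> x /andP[x0 xb]; have -> : - p / (beta - p) + (beta - p)^-1 * x + 0 * x ^+ 2 = (x - p) / (beta - p) by ring.
have [px|xp] := leP p x; first by rewrite ler_pdivrMr // mul1r; lra.
by rewrite ler_pdivrMr // mul0r; lra.
Qed.

(** The polynomial is [x (x - p) / (beta (beta - p))]: it vanishes at 0 and [p], is nonpositive
    between them, and climbs to 1 at [beta]. *)
Let tail3 p : 0 <= p < beta ->
  forall x, 0 <= x <= beta ->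
  0 + (- p / (beta * (beta - p))) * x + (beta * (beta - p))^-1 * x ^+ 2 <= (p <= x)%R%:R.
Proof.
case/andP=> p0 pb x /andP[x0 xb].
have d0 : 0 < beta * (beta - p) by rewrite mulr_gt0; lra.
have -> : 0 + (- p / (beta * (beta - p))) * x + (beta * (beta - p))^-1 * x ^+ 2 =
  x * (x - p) / (beta * (beta - p)) by ring.
rewrite ler_pdivrMr //; have [px|xp] := leP p x; last by rewrite mul0r mulr_ge0_le0 //; lra.
by rewrite mul1r ler_pM //; lra.
Qed.

(** The leading coefficient is positive, so the smallest admissible second moment is the worst. *)
Let value3 p m : 0 <= p < beta -> slo ^+ 2 + mu ^+ 2 <= m <= shi ^+ 2 + mu ^+ 2 ->
  (slo ^+ 2 + mu ^+ 2 - p * mu) / (beta * (beta - p)) <=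
  0 + (- p / (beta * (beta - p))) * mu + (beta * (beta - p))^-1 * m.
Proof.
case/andP=> p0 pb /andP[hm _].
have d0 : 0 < beta * (beta - p) by rewrite mulr_gt0; lra.
have -> : 0 + (- p / (beta * (beta - p))) * mu + (beta * (beta - p))^-1 * m =
  (m - p * mu) / (beta * (beta - p)) by ring.
by rewrite ler_pM2r ?invr_gt0 //; lra.
Qed.

Lemma R3_le_revenue p : 0 < mu -> 0 <= p < beta ->
  ((mu / beta * R2 (mu + slo ^+ 2 / mu) beta p)%:E <= revenue p)%E.
Proof.
move=> mu0 hp; have /andP[p0 pb] := hp.
have -> : mu / beta * R2 (mu + slo ^+ 2 / mu) beta p =
    p * ((slo ^+ 2 + mu ^+ 2 - p * mu) / (beta * (beta - p))).
  by rewrite /R2; field; rewrite !gt_eqF //; lra.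
by apply: (robust_revenue_ge _ _ _ _ _ p0 (tail3 _ hp)) => m; exact: (value3 _ _ hp).
Qed.

(* No quadratic minorizes the indicator of [beta, +oo[ here, so p tends to beta. *)
Lemma mean_le_revenue : 0 < mu -> 0 < beta -> slo ^+ 2 = mu * (beta - mu) ->
  (mu%:E <= revenue beta)%E.
Proof.
move=> mu0 b0 sE.
have muE : beta * (mu / beta) = mu by field; rewrite gt_eqF.
apply: le_ereal_inf_tmp => _ [P PA <-]; rewrite -[in leLHS]muE EFinM.
apply: lee_wpmul2l; first by rewrite lee_fin ltW.
pose F (n : nat) : set (measurableTypeR R) := [set x | beta - beta / n.+1%:R <= x].
have bn n : 0 < beta / n.+1%:R <= beta.
  by rewrite divr_gt0 //= ler_pdivrMr // ler_peMr ?ler1n ?ltW.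
have FE : \bigcap_n F n = [set x | beta <= x].
  apply/seteqP; split=> x /=; last first.
    by move=> bx n _; rewrite /F /= lerBlDr (le_trans bx) // lerDl; have /andP[/ltW] := bn n.
  move=> Fx; rewrite leNgt; apply/negP => xb.
  (* This index [n] satisfies [n + 1 > beta / (beta - x)], hence [x < beta - beta / (n + 1)]. *)
  have := Fx (Num.truncn (beta / (beta - x))) I; rewrite /F /= lerBlDr leNgt => /negP; apply.
  rewrite -ltrBrDl ltr_pdivrMr // mulrC -ltr_pdivrMr ?subr_gt0 //.
  exact: truncnS_gt.
have mF n : measurable (F n) by exact: measurable_ge.
have : P (F n) @[n --> \oo] --> P (\bigcap_n F n).
  apply: nonincreasing_cvg_mu => //.
  - by rewrite ltey_eq fin_num_measure.
  - by rewrite FE; exact: measurable_ge.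
  - move=> n m nm; apply/subsetPset => x; rewrite /F /=; apply: le_trans.
    by rewrite lerD2l lerN2 ler_pM2l // lef_pV2 ?posrE // ler_nat.
rewrite FE => cvgPF; rewrite -(cvg_lim _ cvgPF) //.
apply: lime_ge.
  by apply/cvg_ex; exists (P [set x | beta <= x]).
apply: nearW => n.
have hp : 0 <= beta - beta / n.+1%:R < beta 
  by have /andP[? ?] := bn n; rewrite subr_ge0; apply/andP; split=> //; rewrite ltrBlDr ltrDl.
apply: ambiguity_set_tail_ge _ _ _ _ _ _ PA (tail3 _ hp) _ => m hm; apply: le_trans (value3 _ _ hp hm) => //.
(* Here the least second moment is [mu beta], and the bound equals [mu / beta] for every price below
   [beta]. *)
rewrite sE le_eqVlt; apply/predU1l; field.
by rewrite nat1r pnatr_eq0 subKr (gt_eqF b0).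
Qed.
End TailBounds.

(** * Upper bounds from explicit laws *)

Section RevenueBounds.
Context {R : realType} {mu slo shi beta : R}.
Implicit Types p q x : R.
Local Notation revenue := (robust_revenue mu slo shi beta).
Hypothesis mu_gt0 : 0 < mu.
Hypothesis mu_lt_beta : mu < beta.
Hypothesis slo_ge0 : 0 <= slo.
Hypothesis slo_le_shi : slo <= shi.
Hypothesis shi_gt0 : 0 < shi.
Hypothesis shi_le : shi ^+ 2 <= mu * (beta - mu).

Let slo2_le : slo ^+ 2 <= shi ^+ 2.
Proof. by rewrite ler_sqr ?nnegrE // ltW. Qed.

Let shi2_gt0 : 0 < shi ^+ 2.
Proof. exact: exprn_gt0. Qed.

(** For [q < p] the law on [q] and [mu + shi^2 / (mu - q)] has mean [mu] and variance [shi^2]. The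
    quantity [(mu - p) (beta - mu)] is the variance of the law of mean [mu] on [p] and [beta]; when
    it is at least [shi^2], the upper atom stays within [beta]. *)
Lemma revenue_le_R1 p : 0 < p -> shi ^+ 2 <= (mu - p) * (beta - mu) ->
  (revenue p <= (R1 mu shi p)%:E)%E.
Proof.
have [mu0 mub] := (mu_gt0, mu_lt_beta).
move=> p0 hp; have bmu0 : 0 < beta - mu by lra.
have pmu : p < mu by rewrite -subr_gt0 -(pmulr_lgt0 _ bmu0); exact: lt_le_trans hp.
apply: (@ereal_le_continuous _ (fun q => p * (mu - q) ^+ 2 / ((mu - q) ^+ 2 + shi ^+ 2)) _ 0) => //.
  have d0 : (mu - p) ^+ 2 + shi ^+ 2 != 0 by rewrite gt_eqF // ltr_wpDl // sqr_ge0.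
  have cont2 : (mu - q) ^+ 2 @[q --> p] --> (mu - p) ^+ 2.
    by rewrite expr2; apply: cvgM; apply: cvgB; (exact: cvg_cst || exact: cvg_id).
  apply: cvgM; first by apply: cvgM => //; exact: cvg_cst.
  by apply: cvgV => //; apply: cvgD => //; exact: cvg_cst.
move=> q /andP[q0 qp]; pose v := mu - q; have v0 : 0 < v by rewrite /v; lra.
have d0 : 0 < v ^+ 2 + shi ^+ 2 by rewrite ltr_wpDl // sqr_ge0.
have dv : v * (mu + shi ^+ 2 / v) = mu * v + shi ^+ 2 by field; rewrite gt_eqF.
have x0 : 0 <= shi ^+ 2 / v by rewrite divr_ge0 // ltW.
have xb : mu + shi ^+ 2 / v <= beta.
  rewrite -lerBrDl ler_pdivrMr //; apply: le_trans hp _.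
  by rewrite [leRHS]mulrC ler_wpM2r /v //; lra.
have -> : p * v ^+ 2 / (v ^+ 2 + shi ^+ 2) = p * (shi ^+ 2 / (v ^+ 2 + shi ^+ 2) * (p <= q)%R%:R +
    v ^+ 2 / (v ^+ 2 + shi ^+ 2) * (p <= (mu + shi ^+ 2 / v)%R)%R%:R + 0 * (p <= 0)%R%:R).
  rewrite (leNgt p q) qp mulr0 mul0r add0r addr0.
  by rewrite (_ : p <= _) ?mulr1 ?mulrA //; lra.
apply: robust_revenue_le.
- by rewrite divr_ge0 // ltW.
- by rewrite divr_ge0 ?sqr_ge0 // ltW.
- by [].
- by field; rewrite gt_eqF.
- by apply/andP; split; lra.
- by apply/andP; split; lra.
- by rewrite lexx; lra.
- by rewrite /v; field; rewrite !gt_eqF.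
- have -> : shi ^+ 2 / (v ^+ 2 + shi ^+ 2) * q ^+ 2 +
     v ^+ 2 / (v ^+ 2 + shi ^+ 2) * (mu + shi ^+ 2 / v) ^+ 2 + 0 * 0 ^+ 2 = shi ^+ 2 + mu ^+ 2.
    by rewrite /v; field; rewrite !gt_eqF.
  by rewrite lexx andbT lerD2r.
Qed.

(** The law of mean [mu] on [q] and [beta] has variance [(mu - q) (beta - mu)]. The strict
    inequality at [p] leaves room to take [q] slightly smaller without exceeding [shi^2]. *)
Lemma revenue_le_R2 p : 0 < p -> slo ^+ 2 <= (mu - p) * (beta - mu) < shi ^+ 2 ->
  (revenue p <= (R2 mu beta p)%:E)%E.
Proof.
have [mu0 mub] := (mu_gt0, mu_lt_beta).
move=> p0 /andP[hp1 hp2]; have pmu : p <= mu by have := sqr_ge0 slo; nra.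
(* At [q = lo] the variance is exactly [shi^2]. *)
pose lo := mu - shi ^+ 2 / (beta - mu).
have bmu0 : 0 < beta - mu by lra.
have lop : lo < p by rewrite /lo ltrBlDr -ltrBlDl ltr_pdivlMr.
have lo0 : 0 <= lo by rewrite /lo subr_ge0 ler_pdivrMr.
apply: (@ereal_le_continuous _ (fun q => p * (mu - q) / (beta - q)) _ lo) => //.
  have d0 : beta - p != 0 by rewrite gt_eqF //; lra.
  apply: cvgM; first by apply: cvgM; [exact: cvg_cst|apply: cvgB; (exact: cvg_cst || exact: cvg_id)].
  by apply: cvgV => //; apply: cvgB; (exact: cvg_cst || exact: cvg_id).
move=> q /andP[loq qp].
have bq0 : 0 < beta - q by lra.
have q1 : (mu - q) * (beta - mu) <= shi ^+ 2.
  by rewrite -ler_pdivlMr //; move: loq; rewrite /lo; lra.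
have -> : p * (mu - q) / (beta - q) = p * ((beta - mu) / (beta - q) * (p <= q)%R%:R +
    (mu - q) / (beta - q) * (p <= beta)%R%:R + 0 * (p <= 0)%R%:R).
  rewrite (leNgt p q) qp mulr0 mul0r add0r addr0.
  by rewrite (_ : p <= _) ?mulr1 ?mulrA //; lra.
apply: robust_revenue_le.
- by rewrite divr_ge0; lra.
- by rewrite divr_ge0; lra.
- by [].
- by field; rewrite gt_eqF.
- by apply/andP; split; lra.
- by apply/andP; split; lra.
- by apply/andP; split; lra.
- by field; rewrite gt_eqF.
- have -> : (beta - mu) / (beta - q) * q ^+ 2 + (mu - q) / (beta - q) * beta ^+ 2 + 0 * 0 ^+ 2 =
     (mu - q) * (beta - mu) + mu ^+ 2.
    by field; rewrite gt_eqF.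
  by rewrite !lerD2r q1 andbT (le_trans hp1) // ler_wpM2r; lra.
Qed.

(** Atoms at 0, [q] and [beta]; the weights solve the linear system given by total mass 1, mean [mu]
    and second moment [slo^2 + mu^2]. The weight at 0 is nonnegative exactly when
    [(mu - q) (beta - mu) <= slo^2]. *)
Let revenue_le_three_points q p : 0 < q < p -> p <= beta ->
  (mu - q) * (beta - mu) <= slo ^+ 2 -> p * mu <= slo ^+ 2 + mu ^+ 2 ->
  (revenue p <= (p * (slo ^+ 2 + mu ^+ 2 - q * mu) / (beta * (beta - q)))%:E)%E.
Proof.
have [mu0 mub] := (mu_gt0, mu_lt_beta).
move=> /andP[q0 qp] pb hq hp.
have b0 : 0 < beta by lra.
have bq0 : 0 < beta - q by lra.
have p0 : 0 < p by lra.
have m_ge : q * mu <= slo ^+ 2 + mu ^+ 2 by rewrite (le_trans _ hp) // ler_wpM2r; lra.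
have m_le : slo ^+ 2 + mu ^+ 2 <= beta * mu by have := le_trans slo2_le shi_le; lra.
pose w1 := ((beta - mu) * (q - mu) + slo ^+ 2) / (q * beta).
pose w2 := (beta * mu - (slo ^+ 2 + mu ^+ 2)) / (q * (beta - q)).
pose w3 := (slo ^+ 2 + mu ^+ 2 - q * mu) / (beta * (beta - q)).
have -> : p * (slo ^+ 2 + mu ^+ 2 - q * mu) / (beta * (beta - q)) =
    p * (w1 * (p <= 0)%R%:R + w2 * (p <= q)%R%:R + w3 * (p <= beta)%R%:R).
  by rewrite (leNgt p q) qp (leNgt p 0) p0 !mulr0 !add0r pb mulr1 mulrA.
apply: robust_revenue_le.
- by apply: divr_ge0; [lra|rewrite mulr_ge0 // ltW].
- by apply: divr_ge0; [lra|rewrite mulr_ge0 // ltW].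
- by apply: divr_ge0; [lra|rewrite mulr_ge0 // ltW].
- by rewrite /w1 /w2 /w3; field; rewrite !gt_eqF.
- by apply/andP; split; lra.
- by apply/andP; split; lra.
- by apply/andP; split; lra.
- by rewrite /w1 /w2 /w3; field; rewrite !gt_eqF.
- have -> : w1 * 0 ^+ 2 + w2 * q ^+ 2 + w3 * beta ^+ 2 = slo ^+ 2 + mu ^+ 2.
    by rewrite /w1 /w2 /w3; field; rewrite !gt_eqF.
  by rewrite lexx lerD2r.
Qed.

(** Strictness at [p] gives a left neighbourhood of [p] where [q] can be placed while the weight at
    0 stays nonnegative. *)
Let lo3 p : (mu - p) * (beta - mu) < slo ^+ 2 -> 0 < p ->
  exists2 lo, 0 <= lo < p & forall q, lo < q -> (mu - q) * (beta - mu) <= slo ^+ 2.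
Proof.
have [mu0 mub] := (mu_gt0, mu_lt_beta).
have bmu0 : 0 < beta - mu by lra.
move=> hp p0; exists (mu - slo ^+ 2 / (beta - mu)).
  by rewrite subr_ge0 ler_pdivrMr // (le_trans slo2_le) //= ltrBlDr -ltrBlDl ltr_pdivlMr.
by move=> q loq; rewrite -ler_pdivlMr //; lra.
Qed.

Lemma revenue_le_R3 p : 0 < p < beta ->
  (mu - p) * (beta - mu) < slo ^+ 2 -> p <= mu + slo ^+ 2 / mu ->
  (revenue p <= (mu / beta * R2 (mu + slo ^+ 2 / mu) beta p)%:E)%E.
Proof.
have [mu0 mub] := (mu_gt0, mu_lt_beta).
move=> /andP[p0 pb] hp1; rewrite -lerBlDl ler_pdivlMr // => hp2.
have [lo /andP[lo0 lop] hlo] := lo3 _ hp1 p0.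
have -> : mu / beta * R2 (mu + slo ^+ 2 / mu) beta p =
    p * (slo ^+ 2 + mu ^+ 2 - p * mu) / (beta * (beta - p)).
  by rewrite /R2; field; rewrite !gt_eqF //; lra.
apply: (@ereal_le_continuous _ (fun q => p * (slo ^+ 2 + mu ^+ 2 - q * mu) / (beta * (beta - q))) _ lo) => //.
  have d0 : beta * (beta - p) != 0 by rewrite gt_eqF // mulr_gt0 //; lra.
  apply: cvgM.
    apply: cvgM; first exact: cvg_cst.
    by apply: cvgB; [exact: cvg_cst|apply: cvgM; (exact: cvg_cst || exact: cvg_id)].
  apply: cvgV => //; apply: cvgM; first exact: cvg_cst.
  by apply: cvgB; (exact: cvg_cst || exact: cvg_id).
move=> q /andP[loq qp]; apply: revenue_le_three_points; rewrite ?qp ?(le_lt_trans lo0) ?(ltW pb) ?hlo //.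
by lra.
Qed.

Lemma revenue_le_mean : slo ^+ 2 = mu * (beta - mu) -> (revenue beta <= mu%:E)%E.
Proof.
have [mu0 mub] := (mu_gt0, mu_lt_beta).
move=> sE; have b0 : 0 < beta by lra.
have [|//|lo /andP[lo0 lob] hlo] := lo3 beta; first by rewrite sE; nra.
(* For this [slo] the three-point bound does not depend on [q], so the midpoint replaces a limit. *)
have {2}-> : mu = beta * (slo ^+ 2 + mu ^+ 2 - ((lo + beta) / 2) * mu) / (beta * (beta - (lo + beta) / 2)).
  by rewrite sE; field; rewrite !gt_eqF //; lra.
apply: revenue_le_three_points => //.
- by apply/andP; split; lra.
- by apply: hlo; lra.
- by rewrite sE; nra.
Qed.

(** The law on 0 and [mu + slo^2 / mu] with mean [mu] has second moment [slo^2 + mu^2], and both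
    atoms lie below [p]. *)
Lemma revenue_le0 p : p <= beta -> mu + slo ^+ 2 / mu < p -> (revenue p <= 0)%E.
Proof.
have [mu0 mub] := (mu_gt0, mu_lt_beta).
move=> pb; set a := mu + slo ^+ 2 / mu => hp.
have a_ge : mu <= a by rewrite lerDl divr_ge0 ?sqr_ge0 // ltW.
have -> : 0%E = (p * ((1 - mu / a) * (p <= 0)%R%:R + mu / a * (p <= a)%R%:R + 0 * (p <= 0)%R%:R))%:E.
  by rewrite (leNgt p a) hp (leNgt p 0) (_ : 0 < p) /= ?mulr0 ?addr0 ?mulr0 //; lra.
apply: robust_revenue_le.
- by rewrite subr_ge0 ler_pdivrMr ?mul1r; lra.
- by rewrite divr_ge0; lra.
- by [].
- by field; rewrite gt_eqF; lra.
- by apply/andP; split; lra.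
- by apply/andP; split; lra.
- by apply/andP; split; lra.
- by field; rewrite gt_eqF; lra.
- have -> : (1 - mu / a) * 0 ^+ 2 + mu / a * a ^+ 2 + 0 * 0 ^+ 2 = slo ^+ 2 + mu ^+ 2.
    by rewrite /a; field; rewrite !gt_eqF //; have := sqr_ge0 slo; have := sqr_ge0 mu; nra.
  by rewrite lexx lerD2r.
Qed.
End RevenueBounds.

(** * Maxima of the three bounds *)

Section Algebra.
Context {R : realType}.
Implicit Types mu beta c p y S V : R.

(* With x = mu - p and y a root of y^3 + 3 S^2 y = 2 mu S^2, the gap between the two
   sides is (x - y)^2 (x + y/2) / (x^2 + S^2). *)
Lemma R1_le mu S y p :
  0 < S -> 0 < y -> y ^+ 3 + 3 * S ^+ 2 * y = 2 * mu * S ^+ 2 -> p < mu ->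
  R1 mu S p <= mu - 3 / 2 * y ?= iff (p == mu - y).
Proof.
move=> S0 y0 yE pmu.
have d0 : 0 < (mu - p) ^+ 2 + S ^+ 2 by have := sqr_ge0 (mu - p); nra.
have gapE : mu - 3 / 2 * y - R1 mu S p =
  (mu - p - y) ^+ 2 * (mu - p + y / 2) / ((mu - p) ^+ 2 + S ^+ 2).
  have -> : mu - 3 / 2 * y - R1 mu S p =
   (((mu - 3 / 2 * y) * ((mu - p) ^+ 2 + S ^+ 2)) - p * (mu - p) ^+ 2) / ((mu - p) ^+ 2 + S ^+ 2).
    by rewrite /R1; field; rewrite gt_eqF.
  congr (_ / _).
  have -> : (mu - 3 / 2 * y) * ((mu - p) ^+ 2 + S ^+ 2) - p * (mu - p) ^+ 2 =
    (mu - 3 / 2 * y) * (mu - p) ^+ 2 - p * (mu - p) ^+ 2 + (2 * mu * S ^+ 2 - 3 * S ^+ 2 * y) / 2 by field.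
  by rewrite -yE; field.
have f0 : 0 < (mu - p + y / 2) / ((mu - p) ^+ 2 + S ^+ 2).
  by rewrite divr_gt0 //; lra.
split; first by rewrite -subr_ge0 gapE -mulrA mulr_ge0 ?sqr_ge0 // ltW.
rewrite eq_sym -subr_eq0 gapE -mulrA mulf_eq0 (gt_eqF f0) orbF sqrf_eq0.
by apply/eqP/eqP; lra.
Qed.

(** Expressing [c] through the root [r] turns the gap into [(beta - p - r)^2 / (beta - p)]. It
    serves [R2] with [c = mu] and the third bound with [c = mu + slo^2 / mu]. *)
Lemma mobius_le beta c p : 0 < beta -> c <= beta -> p < beta ->
  p * (c - p) / (beta - p) <= (beta - Num.sqrt (beta * (beta - c))) ^+ 2 / beta
  ?= iff (p == beta - Num.sqrt (beta * (beta - c))).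
Proof.
move=> b0 cb pb; set r := Num.sqrt _.
have r2 : r ^+ 2 = beta * (beta - c) by rewrite sqr_sqrtr // mulr_ge0 ?subr_ge0 // ltW.
have cE : c = beta - r ^+ 2 / beta by rewrite r2; field; rewrite gt_eqF.
have u0 : 0 < beta - p by lra.
have gapE : (beta - r) ^+ 2 / beta - p * (c - p) / (beta - p) = (beta - p - r) ^+ 2 / (beta - p).
  by rewrite cE; field; rewrite !gt_eqF.
split; first by rewrite -subr_ge0 gapE divr_ge0 ?sqr_ge0 // ltW.
rewrite eq_sym -subr_eq0 gapE mulf_eq0 invr_eq0 (gt_eqF u0) orbF sqrf_eq0.
by apply/eqP/eqP; lra.
Qed.

Lemma cbrt_cube (x : R) : cbrt x ^+ 3 = x.
Proof.
rewrite /cbrt exprMn -[X in _ * X]powR_mulrn ?powR_ge0 // -powRrM mulVf ?pnatr_eq0 // powRr1 //.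
have [->|x0] := eqVneq x 0; first by rewrite normr0 mulr0.
have -> : Num.sg x ^+ 3 = Num.sg x by case: sgrP => _; rewrite ?expr0n //= ?expr1n // exprS sqrrN expr1n mulr1.
by rewrite -numEsg.
Qed.

Lemma cbrtM (x y : R) : cbrt (x * y) = cbrt x * cbrt y.
Proof. by rewrite /cbrt sgrM normrM powRM // mulrACA. Qed.

Lemma cbrtN1 : cbrt (-1 : R) = -1.
Proof. by rewrite /cbrt sgrN sgr1 normrN normr1 powR1 mulr1. Qed.

(** Cardano's formula: the radicands multiply to -1, hence so do their cube roots [u] and [v], and
    the mixed terms of [(u + v)^3] reduce to [-3 (u + v)]. *)
Lemma kappa_cubic mu S : kappa mu S ^+ 3 + 3 * kappa mu S = 2 * (mu / S).
Proof.
rewrite /kappa; set a := mu / S; set w := Num.sqrt _.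
have w2 : w ^+ 2 = 1 + a ^+ 2 by rewrite sqr_sqrtr // addr_ge0 // sqr_ge0.
have := cbrt_cube (a + w); have := cbrt_cube (a - w).
have : cbrt (a + w) * cbrt (a - w) = -1.
  rewrite -cbrtM -cbrtN1; congr cbrt.
  have -> : (a + w) * (a - w) = a ^+ 2 - w ^+ 2 by ring.
  by rewrite w2; ring.
move: (cbrt (a + w)) (cbrt (a - w)) => u v uv v3 u3.
have -> : (u + v) ^+ 3 + 3 * (u + v) = u ^+ 3 + v ^+ 3 + 3 * (u * v + 1) * (u + v) by ring.
by rewrite u3 v3 uv; ring.
Qed.

Lemma kappa_gt0 mu S : 0 < mu -> 0 < S -> 0 < kappa mu S.
Proof.
move=> m0 S0; have := kappa_cubic mu S.
have : 0 < mu / S by rewrite divr_gt0.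
move: (kappa mu S) => k a0 kE; rewrite ltNge; apply/negP => k0.
have : k * (k ^+ 2 + 3) <= 0 by rewrite mulr_le0_ge0 // addr_ge0 // sqr_ge0.
by nra.
Qed.

Lemma kappa_cubic_scaled mu S : 0 < S ->
  (S * kappa mu S) ^+ 3 + 3 * S ^+ 2 * (S * kappa mu S) = 2 * mu * S ^+ 2.
Proof.
move=> S0.
have -> : (S * kappa mu S) ^+ 3 + 3 * S ^+ 2 * (S * kappa mu S) =
  S ^+ 3 * (kappa mu S ^+ 3 + 3 * kappa mu S) by ring.
by rewrite kappa_cubic; field; rewrite gt_eqF.
Qed.

(** Makes both the price [mu - y] and the maximum [mu - 3 y / 2] positive. *)
Lemma cubic_root_lt mu S y : 0 < S -> 0 < y ->
  y ^+ 3 + 3 * S ^+ 2 * y = 2 * mu * S ^+ 2 -> 3 * y < 2 * mu.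
Proof.
move=> S0 y0 yE; have s2 : 0 < S ^+ 2 by exact: exprn_gt0.
rewrite -(ltr_pM2r s2) -yE; have : 0 < y ^+ 3 by exact: exprn_gt0.
lra.
Qed.

End Algebra.

(** * Location of the optimal prices *)

Section Optimum.
Context {R : realType} {mu beta slo shi : R}.
Hypothesis mu_gt0 : 0 < mu.
Hypothesis mu_lt_beta : mu < beta.
Hypothesis slo_ge0 : 0 <= slo.
Hypothesis slo_le_shi : slo <= shi.
Hypothesis shi_gt0 : 0 < shi.
Hypothesis shi2_le : shi ^+ 2 <= mu * (beta - mu).

Local Notation revenue := (robust_revenue mu slo shi beta).
Local Notation a := (mu + slo ^+ 2 / mu).
Local Notation optimal := (optimal_robust_prices mu slo shi beta).
Let peak_l := mu - 3 / 2 * (shi * kappa mu shi).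
Let peak_m := (beta - Num.sqrt (beta * (beta - mu))) ^+ 2 / beta.
Let peak_h := mu / beta * ((beta - Num.sqrt (beta * (beta - a))) ^+ 2 / beta).

Let y_gt0 : 0 < shi * kappa mu shi.
Proof. by rewrite mulr_gt0 ?kappa_gt0. Qed.

Let y_cubic := kappa_cubic_scaled mu _ shi_gt0.

Let y_lt := cubic_root_lt _ _ _ shi_gt0 y_gt0 y_cubic.

Let R1_leif p : p < mu -> R1 mu shi p <= peak_l ?= iff (p == price_l mu shi).
Proof. exact: R1_le. Qed.

Let R2_leif p : p < beta -> R2 mu beta p <= peak_m ?= iff (p == price_m mu beta).
Proof. by move=> pb; apply: mobius_le => //; [exact: lt_trans mu_lt_beta|exact: ltW]. Qed.

Let beta_gt0 : 0 < beta.
Proof. exact: lt_trans mu_lt_beta. Qed.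

Let a_le : a <= beta.
Proof.
rewrite -lerBrDl ler_pdivrMr // mulrC; apply: le_trans shi2_le.
by rewrite ler_sqr ?nnegrE // ltW.
Qed.

Let price_hE : price_h mu slo beta = beta - Num.sqrt (beta * (beta - a)).
Proof. by rewrite /price_h opprD addrA. Qed.

Let R3_leif p : p < beta ->
  mu / beta * R2 a beta p <= peak_h ?= iff (p == price_h mu slo beta).
Proof.
move=> pb; have [le eq] := mobius_le beta a p beta_gt0 a_le pb.
have c0 : 0 < mu / beta by exact: divr_gt0.
split; first by rewrite ler_pM2l.
by rewrite price_hE -eq (inj_eq (mulfI _)) // gt_eqF.
Qed.

Let price_l_in : 0 < price_l mu shi < mu.
Proof. by have y0 := y_gt0; have yl := y_lt; have m0 := mu_gt0; rewrite /price_l; apply/andP; split; lra. Qed.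

Let sqrt_lt c : 0 < c <= beta -> 0 < beta - Num.sqrt (beta * (beta - c)) <= beta.
Proof.
move=> /andP[c0 cb]; have b0 := beta_gt0.
rewrite subr_gt0 gerBl sqrtr_ge0 andbT -ltr_sqr ?nnegrE ?sqrtr_ge0 ?(ltW b0) //.
rewrite sqr_sqrtr; last by rewrite mulr_ge0 ?(ltW b0) // subr_ge0.
by rewrite [ltRHS]expr2 ltr_pM2l // gtrBl.
Qed.

Let price_m_in : 0 < price_m mu beta < beta.
Proof.
have /andP[-> _] : 0 < price_m mu beta <= beta by apply: sqrt_lt; rewrite mu_gt0 ltW.
by rewrite gtrBl sqrtr_gt0 mulr_gt0 // subr_gt0.
Qed.

Let a_gt0 : 0 < a.
Proof. by rewrite ltr_wpDr // divr_ge0 ?sqr_ge0 // ltW. Qed.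

Let price_h_in : 0 < price_h mu slo beta <= beta.
Proof. by rewrite price_hE; apply: sqrt_lt; rewrite a_gt0. Qed.

Let peak_h_gt0 : 0 < peak_h.
Proof.
have /andP[h0 _] := price_h_in; rewrite /peak_h -price_hE.
by rewrite mulr_gt0 ?divr_gt0 ?exprn_gt0.
Qed.

(** When [a] reaches [beta], [price_h] equals [beta], where the third bound would divide by zero;
    this case is treated separately with maximum [mu]. *)
Let degenerate : beta <= a -> slo ^+ 2 = mu * (beta - mu).
Proof.
move=> ba; have aE : a = beta by apply/eqP; rewrite eq_le ba a_le.
by rewrite -aE; field; rewrite gt_eqF.
Qed.

Let degenerate_price : beta <= a -> price_h mu slo beta = beta /\ peak_h = mu.
Proof.
move=> ba; have aE : a = beta by apply/eqP; rewrite eq_le ba a_le.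
rewrite price_hE /peak_h aE subrr mulr0 sqrtr0 subr0; split=> //.
by field; rewrite gt_eqF.
Qed.

Let peak_l_le : (peak_l%:E <= revenue (price_l mu shi))%E.
Proof.
have /andP[p0 pm] := price_l_in.
have [_] := R1_leif _ pm; rewrite eqxx => /eqP <-.
by apply: R1_le_revenue; rewrite pm ltW.
Qed.

Let peak_m_le : (peak_m%:E <= revenue (price_m mu beta))%E.
Proof.
have /andP[p0 pm] := price_m_in.
have [_] := R2_leif _ pm; rewrite eqxx => /eqP <-.
by apply: R2_le_revenue; rewrite pm ltW.
Qed.

Let peak_h_le : (peak_h%:E <= revenue (price_h mu slo beta))%E.
Proof.
have [ba|ab] := leP beta a.
  have [-> ->] := degenerate_price ba.
  by apply: mean_le_revenue => //; exact: degenerate.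
have /andP[p0 _] := price_h_in.
have pm : price_h mu slo beta < beta.
  by rewrite price_hE gtrBl sqrtr_gt0 mulr_gt0 // subr_gt0.
have [_] := R3_leif _ pm; rewrite eqxx => /eqP <-.
by apply: R3_le_revenue; rewrite ?pm ?ltW.
Qed.

(** The equality case is kept so that revenue [M] at [p] forces [p = q]. *)
Let bounded_by (p M q : R) := exists2 v, (revenue p <= v%:E)%E & v <= M ?= iff (p == q).

Let revenue_bounded p : 0 < p <= beta -> (revenue p <= 0)%E \/
  [\/ bounded_by p peak_l (price_l mu shi), bounded_by p peak_m (price_m mu beta) |
     bounded_by p peak_h (price_h mu slo beta)].
Proof.
move=> /andP[p0 pb]; have bmu : 0 < beta - mu by rewrite subr_gt0.
(* The regime depends on where the variance of the law on [p] and [beta] lies relative to [slo^2]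
   and [shi^2]. *)
have [A|A] := leP (shi ^+ 2) ((mu - p) * (beta - mu)).
  right; apply: Or31; exists (R1 mu shi p); first exact: revenue_le_R1.
  apply: R1_leif; rewrite -subr_gt0 -(pmulr_lgt0 _ bmu).
  by apply: lt_le_trans A; exact: exprn_gt0.
have [B|B] := leP (slo ^+ 2) ((mu - p) * (beta - mu)).
  right; apply: Or32; exists (R2 mu beta p); first by apply: revenue_le_R2 => //; rewrite B A.
  apply: R2_leif; apply: le_lt_trans mu_lt_beta.
  by rewrite -subr_ge0 -(pmulr_lge0 _ bmu) (le_trans _ B) // sqr_ge0.
have [C|C] := leP p a; last by left; exact: revenue_le0.
right; apply: Or33; move: pb; rewrite le_eqVlt => /predU1P[pE|pb].
  have ba : beta <= a by rewrite -pE.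
  have [hE ME] := degenerate_price ba; rewrite /bounded_by hE ME pE.
  exists mu; last by split; rewrite ?lexx ?eqxx.
  by apply: revenue_le_mean => //; exact: degenerate.
exists (mu / beta * R2 a beta p); last exact: R3_leif.
by apply: revenue_le_R3 => //; rewrite p0.
Qed.

Let revenue_le_max M p : peak_l <= M -> peak_m <= M -> peak_h <= M -> 0 < p <= beta ->
  (revenue p <= M%:E)%E.
Proof.
move=> lM mM hM /revenue_bounded [r0|].
  by apply: le_trans r0 _; rewrite lee_fin (le_trans _ hM) // ltW.
by case=> [] [v rv [vM _]]; apply: le_trans rv _; rewrite lee_fin; apply: le_trans vM _.
Qed.

Lemma optimal_price M q : peak_l <= M -> peak_m <= M -> peak_h <= M ->
  0 < q <= beta -> (M%:E <= revenue q)%E -> optimal q.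
Proof.
move=> lM mM hM hq Mq; split=> //; apply/eqP; rewrite eq_le; apply/andP; split.
  by apply: ereal_sup_ubound; exists q.
apply: ge_ereal_sup => _ [p hp <-]; apply: le_trans Mq.
exact: revenue_le_max.
Qed.

Lemma optimal_l : peak_m <= peak_l -> peak_h <= peak_l -> optimal (price_l mu shi).
Proof.
move=> ml hl; apply: (optimal_price peak_l) => //.
by have /andP[-> pm] := price_l_in; rewrite (le_trans (ltW pm)) // ltW.
Qed.

Lemma optimal_m : peak_l <= peak_m -> peak_h <= peak_m -> optimal (price_m mu beta).
Proof.
move=> ml hl; apply: (optimal_price peak_m) => //.
by have /andP[-> /ltW] := price_m_in.
Qed.

Lemma optimal_h : peak_l <= peak_h -> peak_m <= peak_h -> optimal (price_h mu slo beta).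
Proof. by move=> ml hl; exact: (optimal_price peak_h). Qed.

(** Optimal revenue dominates all three peaks, and zero revenue is excluded by [peak_h > 0]. So the
    peak bounding it is attained, which happens only at that peak's price. *)
Lemma optimal_subset :
  optimal `<=` [set price_l mu shi; price_m mu beta; price_h mu slo beta].
Proof.
move=> p [hp pE].
have ge_rev q : 0 < q <= beta -> (revenue q <= revenue p)%E.
  by move=> hq; rewrite pE; apply: ereal_sup_ubound; exists q.
have ge_l : (peak_l%:E <= revenue p)%E.
  apply: le_trans peak_l_le (ge_rev _ _).
  by have /andP[-> pm] := price_l_in; rewrite (le_trans (ltW pm)) // ltW.
have ge_m : (peak_m%:E <= revenue p)%E.
  by apply: le_trans peak_m_le (ge_rev _ _); have /andP[-> /ltW] := price_m_in.
have ge_h : (peak_h%:E <= revenue p)%E by apply: le_trans peak_h_le (ge_rev _ _).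
case: (revenue_bounded _ hp) => [r0|].
  by have := lt_le_trans (_ : (0 < peak_h%:E)%E) (le_trans ge_h r0); rewrite lte_fin ltxx; move/(_ peak_h_gt0).
have attained M q : (M%:E <= revenue p)%E -> bounded_by p M q -> p = q.
  move=> Mp [v pv [vM /esym E]]; apply/eqP; rewrite E eq_le vM -lee_fin.
  exact: le_trans Mp pv.
case=> [/(attained _ _ ge_l) ->|/(attained _ _ ge_m) ->|/(attained _ _ ge_h) ->].
- by left; left.
- by left; right.
- by right.
Qed.

End Optimum.

(** * Comparison of the maxima *)

Section Comparison.
Context {R : realType}.
Implicit Types mu beta slo y S V : R.

(** The map [y^3 / (2 mu - 3 y)] increases on [0 < y < 2 mu / 3]. Here [S1] and [S2] play the role
    of squared deviations. *)
Lemma cubic_root_mono mu y1 y2 S1 S2 :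
  0 < y1 -> 0 < y2 -> 3 * y1 < 2 * mu -> 3 * y2 < 2 * mu ->
  S1 * (2 * mu - 3 * y1) = y1 ^+ 3 -> S2 * (2 * mu - 3 * y2) = y2 ^+ 3 ->
  (y1 <= y2) = (S1 <= S2).
Proof.
suff H u v S T : 0 < u -> 0 < v -> 3 * u < 2 * mu -> 3 * v < 2 * mu ->
    S * (2 * mu - 3 * u) = u ^+ 3 -> T * (2 * mu - 3 * v) = v ^+ 3 -> u < v -> S < T.
  move=> y10 y20 y1m y2m e1 e2; apply/idP/idP => [|].
    rewrite le_eqVlt => /predU1P[yE|/(H _ _ S1 S2) h]; last exact/ltW/h.
    have d0 : 2 * mu - 3 * y2 != 0 by rewrite gt_eqF //; lra.
    by rewrite le_eqVlt; apply/predU1l/(mulIf d0); rewrite e2 -yE.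
  by apply: contraTT; rewrite -!ltNge; exact: H.
move=> u0 v0 um vm eS eT uv.
have T0 : 0 < T by rewrite -(pmulr_lgt0 _ (_ : 0 < 2 * mu - 3 * v)) ?eT ?exprn_gt0 //; lra.
have d0 : 0 < 2 * mu - 3 * u by lra.
rewrite -(ltr_pM2r d0) eS; apply: (@lt_trans _ _ (v ^+ 3)); first by rewrite ltrXn2r // ltW.
by rewrite -eT ltr_pM2l //; lra.
Qed.

(** * The threshold on [slo] *)

Section Risk.
Context {mu beta slo V : R}.
Hypothesis mu_gt0 : 0 < mu.
Hypothesis mu_lt_beta : mu < beta.
Hypothesis slo2_le : slo ^+ 2 <= mu * (beta - mu).
Hypothesis V_bound : 0 <= V <= mu.

(** [V] stands for the maximum of [R1] or [R2], and [E] is then the radicand in [h] or [g]. Both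
    [M3] and [V] have the form [(beta mu - t)^2 / (mu beta^2)], with [t = A] and [t = B], so
    comparing them amounts to the sign of [A^2 - B^2 = beta mu (E - slo^2)]. *)
Let M3 := mu / beta *
  ((beta - Num.sqrt (beta * (beta - (mu + slo ^+ 2 / mu)))) ^+ 2 / beta).
Let E := 2 * beta * Num.sqrt (V * mu) - beta * V - mu ^+ 2.
Let A := mu * Num.sqrt (beta * (beta - (mu + slo ^+ 2 / mu))).
Let B := beta * (mu - Num.sqrt (V * mu)).

Let beta_gt0 : 0 < beta.
Proof. exact: lt_trans mu_gt0 mu_lt_beta. Qed.

Let a_le : 0 <= beta - (mu + slo ^+ 2 / mu).
Proof. by rewrite opprD addrA subr_ge0 ler_pdivrMr // mulrC. Qed.

Let A_ge0 : 0 <= A.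
Proof. by rewrite mulr_ge0 ?sqrtr_ge0 // ltW. Qed.

Let B_ge0 : 0 <= B.
Proof.
have /andP[V0 Vmu] := V_bound; have mu0 := ltW mu_gt0.
rewrite mulr_ge0 ?(ltW beta_gt0) // subr_ge0 -(ler_sqr _ mu0) ?nnegrE ?sqrtr_ge0 //.
by rewrite sqr_sqrtr ?mulr_ge0 // expr2 ler_wpM2r.
Qed.

Let sqrAB : A ^+ 2 - B ^+ 2 = beta * mu * (E - slo ^+ 2).
Proof.
have /andP[V0 Vmu] := V_bound.
have w2 : Num.sqrt (V * mu) ^+ 2 = V * mu by rewrite sqr_sqrtr // mulr_ge0 // ltW.
rewrite /A /B /E !exprMn sqr_sqrtr; last by rewrite mulr_ge0 // ltW.
have -> : (mu - Num.sqrt (V * mu)) ^+ 2 = mu ^+ 2 - 2 * mu * Num.sqrt (V * mu) + Num.sqrt (V * mu) ^+ 2.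
  by ring.
by rewrite w2; field; rewrite gt_eqF.
Qed.

Let M3_sqr : M3 = (beta * mu - A) ^+ 2 / (mu * beta ^+ 2).
Proof. by rewrite /M3 /A; field; rewrite !gt_eqF. Qed.

Let V_sqr : V = (beta * mu - B) ^+ 2 / (mu * beta ^+ 2).
Proof.
have /andP[V0 Vmu] := V_bound.
have -> : beta * mu - B = beta * Num.sqrt (V * mu) by rewrite /B; ring.
rewrite exprMn sqr_sqrtr; last by rewrite mulr_ge0 // ltW.
by field; rewrite !gt_eqF.
Qed.

Let A_le : A <= beta * mu.
Proof.
have b0 := ltW beta_gt0; rewrite /A mulrC ler_pM2r // -ler_sqr ?nnegrE ?sqrtr_ge0 //.
rewrite sqr_sqrtr; last by rewrite mulr_ge0.
by rewrite [leRHS]expr2 ler_pM2l // gerBl addr_ge0 ?divr_ge0 ?sqr_ge0 // ltW.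
Qed.

Let B_le : B <= beta * mu.
Proof. by rewrite /B ler_pM2l // gerBl sqrtr_ge0. Qed.

Let bm_gt0 : 0 < beta * mu.
Proof. exact: mulr_gt0. Qed.

Let d_gt0 : 0 < (mu * beta ^+ 2)^-1.
Proof. by rewrite invr_gt0 mulr_gt0 // exprn_gt0. Qed.

Lemma peak_h_le : (M3 <= V) = (slo ^+ 2 <= E).
Proof.
rewrite V_sqr M3_sqr ler_pM2r // ler_sqr ?nnegrE ?subr_ge0 // lerD2l lerN2.
by rewrite -ler_sqr ?nnegrE // -subr_ge0 sqrAB pmulr_rge0 // subr_ge0.
Qed.

Lemma peak_h_ge : (V <= M3) = (E <= slo ^+ 2).
Proof.
rewrite V_sqr M3_sqr ler_pM2r // ler_sqr ?nnegrE ?subr_ge0 // lerD2l lerN2.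
by rewrite -ler_sqr ?nnegrE // -subr_le0 sqrAB pmulr_rle0 // subr_le0.
Qed.
End Risk.

(** With [e = r - (beta - mu)] the maximum of [R2] is [mu - 2 e], so the comparison is between [y]
    and [4 e / 3]. The latter solves the same cubic with [S^2] replaced by [F], the radicand of [f],
    and monotonicity of the root concludes. *)
Lemma peak_m_le mu beta y S :
  0 < mu -> mu < beta -> 0 < S -> 0 < y -> y ^+ 3 + 3 * S ^+ 2 * y = 2 * mu * S ^+ 2 ->
  let M2 := (beta - Num.sqrt (beta * (beta - mu))) ^+ 2 / beta in
  (M2 <= mu - 3 / 2 * y) = (S <= f mu beta) /\ (mu - 3 / 2 * y <= M2) = (f mu beta <= S).
Proof.
move=> mu0 mub S0 y0 yE /=; rewrite /f; set r := Num.sqrt (beta * (beta - mu)).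
have d0 : 0 < beta - mu by lra.
have r0 : 0 <= r by exact: sqrtr_ge0.
have r2 : r ^+ 2 = beta * (beta - mu) by rewrite sqr_sqrtr // mulr_ge0 //; lra.
pose e := r - (beta - mu).
have e0 : 0 < e.
  rewrite subr_gt0 -ltr_sqr ?nnegrE ?(ltW d0) // r2 expr2 ltr_pM2r //; lra.
have -> : (beta - r) ^+ 2 / beta = mu - 2 * e.
  have -> : (beta - r) ^+ 2 = beta ^+ 2 - 2 * beta * r + r ^+ 2 by ring.
  by rewrite r2 /e; field; rewrite gt_eqF //; lra.
have F0 : 0 <= 32%:R / 27%:R * (beta - mu) * e by rewrite !mulr_ge0 // ltW.
pose F := 32%:R / 27%:R * (beta - mu) * e.
have muE : mu * (beta - mu) = e * (e + 2 * (beta - mu)).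
  have -> : e * (e + 2 * (beta - mu)) = r ^+ 2 - (beta - mu) ^+ 2 by rewrite /e; ring.
  by rewrite r2; ring.
have e2 : 2 * e < mu.
  rewrite -(ltr_pM2r d0) muE; have : 0 < e * e by exact: mulr_gt0.
  lra.
have y3 := cubic_root_lt _ _ _ S0 y0 yE.
have yE' : S ^+ 2 * (2 * mu - 3 * y) = y ^+ 3 by lra.
have eE : F * (2 * mu - 3 * (4 / 3 * e)) = (4 / 3 * e) ^+ 3.
  have -> : F * (2 * mu - 3 * (4 / 3 * e)) = 32%:R / 27%:R * e * (2 * (mu * (beta - mu)) - 4 * e * (beta - mu)).
    by rewrite /F; field.
  by rewrite muE; field.
have e'0 : 0 < 4 / 3 * e by lra.
have e'3 : 3 * (4 / 3 * e) < 2 * mu by lra.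
have sq : Num.sqrt F ^+ 2 = F by rewrite sqr_sqrtr.
have h1 := cubic_root_mono _ _ _ _ _ y0 e'0 y3 e'3 yE' eE.
have h2 := cubic_root_mono _ _ _ _ _ e'0 y0 e'3 y3 eE yE'.
rewrite -/e -/F; split.
  rewrite -[in RHS]ler_sqr ?nnegrE ?sqrtr_ge0 ?(ltW S0) // sq -h1.
  by apply/idP/idP; lra.
rewrite -[in RHS]ler_sqr ?nnegrE ?sqrtr_ge0 ?(ltW S0) // sq -h2.
by apply/idP/idP; lra.
Qed.
End Comparison.

(** Settles [slo = 0], where a negative radicand in [g] or [h] gives no information; the two maxima
    then differ by the factor [mu / beta]. *)
Lemma peak_h_le_peak_m {R : realType} (mu beta : R) : 0 < mu -> mu < beta ->
  mu / beta * ((beta - Num.sqrt (beta * (beta - (mu + 0 ^+ 2 / mu)))) ^+ 2 / beta)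
  <= (beta - Num.sqrt (beta * (beta - mu))) ^+ 2 / beta.
Proof.
move=> mu0 mub; have b0 : 0 < beta by lra.
rewrite expr0n mul0r addr0 ler_piMl ?divr_ge0 ?sqr_ge0 ?(ltW b0) //.
by rewrite ler_pdivrMr // mul1r ltW.
Qed.

(** Provides the range condition on [V] for the maximum of [R2]; the upper bound reduces to
    [beta - mu <= r]. *)
Lemma peak_m_le_mean {R : realType} (mu beta : R) : 0 < mu -> mu < beta ->
  0 <= (beta - Num.sqrt (beta * (beta - mu))) ^+ 2 / beta <= mu.
Proof.
move=> mu0 mub; have b0 : 0 < beta by lra.
rewrite divr_ge0 ?sqr_ge0 ?(ltW b0) //=.
set r := Num.sqrt _; have r2 : r ^+ 2 = beta * (beta - mu) by rewrite sqr_sqrtr // mulr_ge0 //; lra.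
have r0 : 0 <= r by exact: sqrtr_ge0.
have dr : beta - mu <= r.
  rewrite -ler_sqr ?nnegrE ?subr_ge0 ?(ltW mub) // r2 expr2 ler_pM2r ?subr_gt0 // gerBl; exact: ltW.
rewrite ler_pdivrMr //.
have -> : (beta - r) ^+ 2 = beta ^+ 2 - 2 * (beta * r) + r ^+ 2 by ring.
have : beta * (beta - mu) <= beta * r by rewrite ler_pM2l.
rewrite r2; lra.
Qed.

(** * Optimal prices on the risk sets *)

Theorem theorem3p1 (R : realType) (mu beta slo shi : R)
    (mu_gt0 : 0 < mu) (mu_lt_beta : mu < beta)
    (slo_ge0 : 0 <= slo) (slo_le_shi : slo <= shi)
    (shi_le : shi <= Num.sqrt (mu * (beta - mu))) (shi_gt0 : 0 < shi) :
  [/\ optimal_robust_prices mu slo shi beta `<=`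
        [set price_l mu shi; price_m mu beta; price_h mu slo beta],
      (Sigma_l mu beta (slo, shi) ->
        optimal_robust_prices mu slo shi beta (price_l mu shi)),
      (Sigma_m mu beta (slo, shi) ->
        optimal_robust_prices mu slo shi beta (price_m mu beta)),
      (Sigma_h mu beta (slo, shi) ->
        optimal_robust_prices mu slo shi beta (price_h mu slo beta))
    & (Sigma_l mu beta `|` Sigma_m mu beta `|` Sigma_h mu beta) (slo, shi)].
Proof.
have shi2_le : shi ^+ 2 <= mu * (beta - mu).
  have mb0 : 0 <= mu * (beta - mu) by rewrite mulr_ge0 ?subr_ge0 // ltW.
  by rewrite -(sqr_sqrtr mb0) ler_sqr ?nnegrE ?sqrtr_ge0 // ltW.
have slo2_le : slo ^+ 2 <= mu * (beta - mu).
  by apply: le_trans shi2_le; rewrite ler_sqr ?nnegrE // ltW.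
set y := shi * kappa mu shi.
have y0 : 0 < y by rewrite mulr_gt0 ?kappa_gt0.
have yE : y ^+ 3 + 3 * shi ^+ 2 * y = 2 * mu * shi ^+ 2 by exact: kappa_cubic_scaled.
have y3 : 3 * y < 2 * mu by exact: cubic_root_lt yE.
(* The equality case of the bound evaluates [R1] at its maximizer. *)
have R1E : R1 mu shi (price_l mu shi) = mu - 3 / 2 * y.
  have pm : price_l mu shi < mu by rewrite gtrBl.
  by have [_] := R1_le _ _ _ _ shi_gt0 y0 yE pm; rewrite eqxx => /eqP.
have R2E : R2 mu beta (price_m mu beta) = (beta - Num.sqrt (beta * (beta - mu))) ^+ 2 / beta.
  have b0 : 0 < beta by exact: lt_trans mu_lt_beta.
  have pb : price_m mu beta < beta by rewrite gtrBl sqrtr_gt0 mulr_gt0 // subr_gt0.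
  by have [_] := mobius_le _ _ _ b0 (ltW mu_lt_beta) pb; rewrite eqxx => /eqP.
have M1_bound : 0 <= R1 mu shi (price_l mu shi) <= mu by rewrite R1E; apply/andP; split; lra.
have M2_bound : 0 <= R2 mu beta (price_m mu beta) <= mu by rewrite R2E peak_m_le_mean.
have [fE1 fE2] := peak_m_le _ _ _ _ mu_gt0 mu_lt_beta shi_gt0 y0 yE.
rewrite -R1E -R2E in fE1 fE2.
have hle V := @peak_h_le _ mu beta slo V mu_gt0 mu_lt_beta slo2_le.
have hge V := @peak_h_ge _ mu beta slo V mu_gt0 mu_lt_beta slo2_le.
have hm0 := peak_h_le_peak_m _ _ mu_gt0 mu_lt_beta; rewrite -R2E in hm0.
have := optimal_subset mu_gt0 mu_lt_beta slo_ge0 slo_le_shi shi_gt0 shi2_le.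
have := optimal_l mu_gt0 mu_lt_beta slo_ge0 slo_le_shi shi_gt0 shi2_le.
have := optimal_m mu_gt0 mu_lt_beta slo_ge0 slo_le_shi shi_gt0 shi2_le.
have := optimal_h mu_gt0 mu_lt_beta slo_ge0 slo_le_shi shi_gt0 shi2_le.
rewrite -/y -R1E -R2E.
set M1 := R1 _ _ _ in fE1 fE2 M1_bound *.
set M2 := R2 _ _ _ in fE1 fE2 M2_bound hm0 *.
set M3 := mu / beta * _ => oh om ol osub.
have sqrt_ge E : Num.sqrt E <= slo -> E <= slo ^+ 2.
  move=> le; have [E0|/ltW E0] := leP 0 E; last by rewrite (le_trans E0) // sqr_ge0.
  by rewrite -(sqr_sqrtr E0) ler_sqr ?nnegrE ?sqrtr_ge0.
(* When E < 0 the square root is the junk value 0, and slo <= Num.sqrt E says slo = 0. *)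
have sqrt_le E : slo <= Num.sqrt E -> slo = 0 \/ slo ^+ 2 <= E.
  move=> le; have [E0|/ltW E0] := leP 0 E.
    by right; rewrite -(sqr_sqrtr E0) ler_sqr ?nnegrE ?sqrtr_ge0.
  by left; apply/eqP; rewrite eq_le slo_ge0 andbT; move: le; rewrite ler0_sqrtr.
have sqrt_leE E : Num.sqrt E <= slo <-> E <= slo ^+ 2.
  split; first exact: sqrt_ge.
  by move=> le; rewrite (le_trans (ler_wsqrtr le)) // sqrtr_sqr ger0_norm.
have hl_iff V : 0 <= V <= mu ->
   (V <= M3) <-> Num.sqrt (2 * beta * Num.sqrt (V * mu) - beta * V - mu ^+ 2) <= slo.
  by move=> hV; rewrite hge // sqrt_leE.
(* If the radicand is negative then [slo = 0], and [M3 <= M2 <= V] is used instead. *)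
have lh V : 0 <= V <= mu -> M2 <= V ->
   slo <= Num.sqrt (2 * beta * Num.sqrt (V * mu) - beta * V - mu ^+ 2) -> M3 <= V.
  move=> hV M2V /sqrt_le[s0|]; last by rewrite -hle.
  by apply: le_trans M2V; rewrite /M3 s0.
split.
- exact: osub.
- move=> [/= _ _ sh sf _]; have M21 : M2 <= M1 by rewrite fE1.
  by apply: ol => //; apply: lh.
- move=> [/= _ _ sg fs _]; have M12 : M1 <= M2 by rewrite fE2.
  by apply: om => //; apply: lh.
- by move=> [/= _ gs hs _]; apply: oh; apply/hl_iff.
have shi_ge0 := ltW shi_gt0.
(* For coverage, if [slo] passes the threshold of the larger of [M1] and [M2], then [M3] exceeds the
   smaller one too, which yields the other inequality of [Sigma_h]. *)
have [sf|fs] := leP shi (f mu beta).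
  have M21 : M2 <= M1 by rewrite fE1.
  have [sh|/ltW hs] := leP slo (h shi mu beta); first by left; left.
  right; split=> //=; apply/(hl_iff _ M2_bound); apply: le_trans M21 _; exact/hl_iff.
have M12 : M1 <= M2 by rewrite fE2 ltW.
have [sg|/ltW gs] := leP slo (g mu beta); first by left; right; split=> //=; exact: ltW.
right; split=> //=; apply/(hl_iff _ M1_bound); apply: le_trans M12 _; exact/hl_iff.
Qed.
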